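(* For every integer $d\ge2$ there exist constants $n_0\in\mathbb{N}$ and $C_1,C_2,c,\theta>0$, depending only on $d$, such that for every $n\ge n_0$, every positive integer $w$ with $w\mid n$, every integer $r\in\{1,\dots,n\}$, and independent Rademacher vectors $\xi_1,\dots,\xi_d\in\{\pm1\}^n$, $$\sup_{x\in\mathbb{R}}\mathbb{P}\left\{\mathrm{Res}_x^{f^{(w)}}(\xi_1,\dots,\xi_d)\le r\right\}\le C_1\log^{d/2}(n)\sqrt{\frac{w}{n}}\left(\left(1+\frac{r}{\sqrt w}\right)^d-1\right)+C_2\exp\left(-c\left(\sqrt{\frac{n}{w}}\right)^{1/\theta}\right).$$ Moreover, if $w=w(n)=o(n)$ as $n\to\infty$ (with $d$ fixed), then for any $x\in\mathbb{R}$, $$\mathrm{Res}_x^{f^{(w)}}(\xi_1,\dots,\xi_d)=\Omega\left(\sqrt{\frac{w}{\log n}}\left(\frac nw\right)^{\frac1{2d}}\right)\quad\text{a.a.s.}$$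
   Context: $[n]=\{1,\dots,n\}$. A Rademacher vector is a random vector whose entries are i.i.d. and uniform on $\{-1,1\}$. A real tensor $f=(f_{\mathbf i})_{\mathbf i\in[n]^d}$ is identified with the multilinear polynomial $f(x_1,\dots,x_d)=\sum_{\mathbf i\in[n]^d}f_{\mathbf i}\,(x_1)_{\mathbf i_1}\cdots(x_d)_{\mathbf i_d}$. Block-diagonal tensor: for $w\mid n$, $f^{(w)}=(f^{(w)}_{\mathbf i})_{\mathbf i\in[n]^d}$ is the tensor with $f^{(w)}_{\mathbf i}=1$ if there is $a\in[n/w]$ such that $(a-1)w+1\le\mathbf i_s\le aw$ for all $s\in[d]$, and $f^{(w)}_{\mathbf i}=0$ otherwise. Resilience: $\mathrm{Res}_x^f(v_1,\dots,v_d)$, for $v_1,\dots,v_d\in\{\pm1\}^n$ and $x\in\mathbb{R}$, is the Hamming distance (in $\{\pm1\}^{dn}$) from $(v_1,\dots,v_d)$ to the level set $\{(u_1,\dots,u_d)\in(\{\pm1\}^n)^d:f(u_1,\dots,u_d)=x\}$; it is $+\infty$ if this set is empty. ''$\mathrm{Res}_x^f(\xi_1,\dots,\xi_d)=\Omega(h(n))$ a.a.s. for any $x\in\mathbb{R}$'' means: for every $r:\mathbb{N}\to\mathbb{N}$ with $r(n)=o(h(n))$, $\sup_{x\in\mathbb{R}}\mathbb{P}\{\mathrm{Res}_x^f(\xi_1,\dots,\xi_d)\le r(n)\}=o(1)$. *)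

(* Defs.v *)
From HB Require Import structures.
From mathcomp Require Import all_boot all_order all_algebra.
From mathcomp Require Import all_classical all_reals all_analysis.
Import Order.TTheory GRing.Theory Num.Theory.
Import numFieldNormedType.Exports.

Set Implicit Arguments.
Unset Strict Implicit.
Unset Printing Implicit Defensive.

Local Open Scope classical_set_scope.
Local Open Scope ring_scope.

(** A real tensor [f] of order [d] on [[n]], identified with the multilinear
    polynomial [tensor_eval f]. *)
Definition tensor (R : realType) (d n : nat) := {ffun 'I_d -> 'I_n} -> R.

Definition tensor_eval (R : realType) (d n : nat) (f : tensor R d n)
    (u : 'I_d -> 'I_n -> R) : R :=
  \sum_(i : {ffun 'I_d -> 'I_n}) f i * \prod_(s < d) u s (i s).

(** Indices are 0-based: the [a]-th block is [a * w, ..., (a + 1) * w - 1].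
    Only meaningful when [0 < w] and [w %| n]. *)
Definition block_tensor (R : realType) (d n w : nat) : tensor R d n :=
  fun i => ([exists a : 'I_(n %/ w),
    [forall s : 'I_d, (a * w <= i s < a.+1 * w)%N]] : bool)%:R.

(** The points of {-1, 1}^n, a bit [b] standing for the sign [(-1) ^+ b];
    [signs] gives the actual entries. *)
Definition cube (n : nat) := {ffun 'I_n -> bool}.

Definition signs (R : realType) (d n : nat) (u : 'I_d -> cube n) :
  'I_d -> 'I_n -> R := fun s i => (-1) ^+ (u s i).

Definition hamming (d n : nat) (u v : 'I_d -> cube n) : nat :=
  (\sum_(s < d) #|[set i : 'I_n | u s i != v s i]%SET|)%N.

(** Infimum in the extended reals, hence [+oo] when the level set is empty. *)
Definition resilience (R : realType) (d n : nat) (f : tensor R d n) (x : R)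
    (v : 'I_d -> cube n) : \bar R :=
  ereal_inf [set ((hamming v u)%:R : R)%:E |
             u in [set u : 'I_d -> cube n | tensor_eval f (signs R u) = x]].

Section random.
Context (R : realType) (disp : measure_display) (T : measurableType disp).
Variable P : probability T R.

(** Random elements of a finite type carrying the discrete sigma-algebra. *)
Definition discrete_rv (F : finType) (X : T -> F) : Prop :=
  forall A : set F, measurable (X @^-1` A).

Definition mutually_independent (I F : finType) (X : I -> T -> F) : Prop :=
  forall (J : {set I}) (A : I -> set F),
    P (\bigcap_(i in [set` J]) (X i @^-1` A i)) =
    (\prod_(i in J) P (X i @^-1` A i))%E.

Definition rademacher_vector (n : nat) (X : T -> cube n) : Prop :=
  [/\ discrete_rv X,
      forall (i : 'I_n) (b : bool), P [set t | X t i = b] = (2^-1 : R)%:E &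
      mutually_independent (fun (i : 'I_n) (t : T) => X t i)].

Definition independent_rademacher_vectors (d n : nat)
    (xi : 'I_d -> T -> cube n) : Prop :=
  (forall s, rademacher_vector (xi s)) /\ mutually_independent xi.

Definition sup_prob_resilience_le (d n : nat) (f : tensor R d n)
    (xi : 'I_d -> T -> cube n) (r : nat) : \bar R :=
  ereal_sup [set P [set t | (resilience f x (xi ^~ t) <= (r%:R : R)%:E)%E] |
             x in [set: R]].

End random.

(** [Res_x(xi_1, ..., xi_d) = Omega(h(n))] a.a.s. for any [x], for random
    vectors that may live on a different probability space for each [n]. *)
Definition resilience_aas_Omega (R : realType) (d : nat)
    (disp : nat -> measure_display)
    (T : forall n, measurableType (disp n))
    (P : forall n, probability (T n) R)
    (f : forall n, tensor R d n)
    (xi : forall n, 'I_d -> T n -> cube n) (h : nat -> R) : Prop :=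
  forall r : nat -> nat,
    (fun n => (r n)%:R : R^o) =o_\oo (h : nat -> R^o) ->
    (fun n => sup_prob_resilience_le (P n) (f n) (xi n) (r n)) @ \oo --> 0%E.

(* Main.v *)
Require Import Defs.
From HB Require Import structures.
From mathcomp Require Import all_boot all_order all_algebra.
From mathcomp Require Import all_classical all_reals all_analysis.
From mathcomp Require Import ring lra zify.
Import Order.TTheory GRing.Theory Num.Theory.
Import numFieldNormedType.Exports.

Set Implicit Arguments.
Unset Strict Implicit.
Unset Printing Implicit Defensive.

Local Open Scope classical_set_scope.
Local Open Scope ring_scope.

(** Write [S_s(a)] for the sum of the [w] signs of row [s] in block [a]; the
    polynomial is [f = \sum_a \prod_s S_s(a)], with [m = n / w] blocks.  If some
    point at distance at most [r] from [u] lies on the level set of [x], then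
    [f u] is close to [x]: as long as every [`|S_s(a)|] is at most
    [M = L * sqrt w], changing [r] signs moves [f] by at most
    [(M + 2 r)^d - M^d] ([block_form_perturbation]), which for [L >= 2] is at most
    [t = L^d w^(d/2) ((1 + r / sqrt w)^d - 1)].  So resilience at most [r] at [x]
    forces one of three events.

    - Some [`|S_s(a)|] exceeds [L * sqrt w]: this has probability at most
      [2 d m exp (- L^2 / 8)] ([cell_sum_tail]).
    - Few blocks are good, in the sense that [`|S_s(a)| >= sqrt w / 2] for every
      row [s] other than one distinguished row: blocks are independent and each
      one is good with probability at least [p = (3/16)^(d-1)], so that fewer
      than [p m / 4] of them are good with probability at most
      [exp (- p m / 4)] ([few_good_blocks]).
    - Many blocks are good and [`|f u - x| <= t].  Given the other rows, [f] is a
      linear form in the distinguished row, with at least [p n / 4] coefficients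
      of size at least [(sqrt w / 2)^(d-1)], and the Littlewood-Offord inequality
      of Erdos ([littlewood_offord]) bounds the probability by a constant times
      [(t / w^((d-1)/2) + 1) / sqrt n].

    With [L = 4 sqrt (ln n)] the sum of the three bounds is the tail estimate,
    with [theta = 1/2].  For the asymptotic statement the choice is
    [L = 4 sqrt (ln m)] instead: a union bound over [d m] cells needs no more,
    and it makes the bound tend to 0 as soon as [m] tends to infinity, even when
    [m] is much smaller than a power of [ln n] ([log_bound_vanishes]). *)

(** * Averages over sign vectors *)

Definition avg (R : realType) (I : finType) (g : {ffun I -> bool} -> R) : R :=
  (\sum_v g v) / 2 ^+ #|I|.

Section average.
Context (R : realType) (I : finType).
Implicit Types (g h : {ffun I -> bool} -> R) (u v : {ffun I -> bool}).

Lemma eq_avg g h : g =1 h -> avg g = avg h.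
Proof. by move=> gh; rewrite /avg; under eq_bigr do rewrite gh. Qed.

Lemma ler_avg g h : (forall v, g v <= h v) -> avg g <= avg h.
Proof.
by move=> gh; rewrite ler_pM2r ?invr_gt0 ?exprn_gt0 //; exact: ler_sum.
Qed.

Lemma avg_const (c : R) : avg (fun _ : {ffun I -> bool} => c) = c.
Proof.
rewrite /avg sumr_const card_ffun card_bool -[c *+ _]mulr_natr natrX mulfK //.
Qed.

Lemma avgD g h : avg (fun v => g v + h v) = avg g + avg h.
Proof. by rewrite /avg big_split mulrDl. Qed.

Lemma avgZ (c : R) g : avg (fun v => c * g v) = c * avg g.
Proof. by rewrite /avg -mulr_sumr mulrA. Qed.

Lemma avg_sum (K : Type) (r : seq K) (p : pred K) (g : K -> {ffun I -> bool} -> R) :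
  avg (fun v => \sum_(k <- r | p k) g k v) = \sum_(k <- r | p k) avg (g k).
Proof. by rewrite /avg exchange_big mulr_suml. Qed.

Lemma avg_ge0 g : (forall v, 0 <= g v) -> 0 <= avg g.
Proof. by move=> g0; rewrite -[leLHS](avg_const 0) ler_avg. Qed.

Definition mix (B : pred I) u v : {ffun I -> bool} :=
  [ffun i => if B i then v i else u i].

(** Exchanging the coordinates in [B] between [u] and [v] is an involution of
    the pairs [(u, v)], hence preserves the uniform measure on pairs. *)
Lemma avg_resample (B : pred I) h :
  avg h = avg (fun u => avg (fun v => h (mix B u v))).
Proof.
rewrite /avg -mulr_suml; congr (_ / _).
pose F (p : {ffun I -> bool} * {ffun I -> bool}) := (mix B p.1 p.2, mix B p.2 p.1).
have FK : involutive F.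
  by move=> [u v]; congr pair; apply/ffunP => i; rewrite !ffunE /=; case: (B i).
rewrite pair_bigA /= [X in X / _](reindex_inj (inv_inj FK)) /=.
rewrite (eq_bigr (fun p => h p.1)) => [|p _]; last first.
  by congr h; apply/ffunP => i; rewrite !ffunE; case: (B i).
rewrite -(pair_bigA _ (fun u v => h u)) /=.
rewrite exchange_big /= sumr_const card_ffun card_bool -[_ *+ (2 ^ _)]mulr_natr.
by rewrite natrX mulfK.
Qed.

(** Resampling the coordinates in [B] replaces [g * h] by a product of functions
    of two independent points. *)
Lemma avg_indep (B : pred I) g h :
  (forall u v, g (mix B u v) = g v) -> (forall u v, h (mix B u v) = h u) ->
  avg (fun v => g v * h v) = avg g * avg h.
Proof.
move=> gB hB; rewrite (avg_resample B) -avgZ; apply: eq_avg => u.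
under eq_avg do rewrite gB hB mulrC.
by rewrite avgZ mulrC.
Qed.

(** Functions reading disjoint sets of coordinates, the fibres of [key], are
    independent. *)
Lemma avg_prod (K : finType) (key : I -> K) (p : pred K)
    (g : K -> {ffun I -> bool} -> R) :
  (forall k u v, (forall i, key i = k -> u i = v i) -> g k u = g k v) ->
  avg (fun v => \prod_(k | p k) g k v) = \prod_(k | p k) avg (g k).
Proof.
move=> gkey; have := index_enum_uniq K; elim: (index_enum K) => [|k r IH] /=.
  by move=> _; under eq_avg do rewrite big_nil; rewrite avg_const big_nil.
case/andP=> kr /IH {}IH; rewrite big_cons; under eq_avg do rewrite big_cons.
case: ifP => // _; rewrite -IH; apply: (avg_indep (B := fun i => key i == k)).
  by move=> u v; apply: gkey => i ik; rewrite ffunE ik eqxx.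
move=> u v; rewrite big_seq_cond [RHS]big_seq_cond; apply: eq_bigr => l /andP[lr _].
apply: gkey => i il; rewrite ffunE il; case: (eqVneq l k) => // lk.
by move: kr; rewrite -lk lr.
Qed.

Definition upd (j : I) (b : bool) v : {ffun I -> bool} :=
  [ffun i => if i == j then b else v i].

Lemma avg_upd (j : I) h :
  avg h = (avg (fun v => h (upd j false v)) + avg (fun v => h (upd j true v))) / 2.
Proof.
pose flip v := upd j (~~ v j) v.
have flipK : involutive flip.
  move=> v; apply/ffunP => i; rewrite !ffunE eqxx negbK.
  by case: eqP => [->|].
have -> : avg h = (avg h + avg (fun v => h (flip v))) / 2.
  have -> : avg (fun v => h (flip v)) = avg h.
    by rewrite /avg [in RHS](reindex_inj (inv_inj flipK)).
  by field.
rewrite -!avgD; congr (_ / 2); apply: eq_avg => v.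
rewrite /flip; case vj: (v j) => /=; first rewrite addrC; congr (h _ + h _) => //;
  by apply/ffunP => i; rewrite !ffunE; case: eqP => // ->.
Qed.

Lemma avg_signs_cons (c : I -> R) (j : I) (s : seq I) (h : R -> R) :
  j \notin s ->
  avg (fun v => h (\sum_(i <- j :: s) c i * (-1) ^+ v i)) =
  (avg (fun v => h (\sum_(i <- s) c i * (-1) ^+ v i + c j)) +
   avg (fun v => h (\sum_(i <- s) c i * (-1) ^+ v i - c j))) / 2.
Proof.
move=> js; rewrite (avg_upd j).
have E b v : \sum_(i <- j :: s) c i * (-1) ^+ upd j b v i =
    \sum_(i <- s) c i * (-1) ^+ v i + c j * (-1) ^+ b.
  rewrite big_cons addrC ffunE eqxx; congr (_ + _).
  rewrite big_seq [RHS]big_seq; apply: eq_bigr => i si; rewrite ffunE.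
  by case: eqP => // ij; rewrite -ij si in js.
by congr ((_ + _) / 2); apply: eq_avg => v; rewrite E ?expr0 ?expr1 ?mulr1 ?mulrN1.
Qed.

End average.

(** * The Littlewood-Offord inequality *)

(** The sum of the [j] largest coefficients ['C(k, _)]: as [i] runs through 1, 2,
    3..., ['C(k, (k + i)./2)] lists the row from its centre outwards, up to the
    symmetry of the row. *)
Definition top_binomials (k j : nat) : nat :=
  (\sum_(i < j) 'C(k, (k + i.+1)./2))%N.

Lemma top_binomials0 k : top_binomials k 0 = 0%N.
Proof. by rewrite /top_binomials big_ord0. Qed.

Lemma top_binomials_recr k j :
  top_binomials k j.+1 = (top_binomials k j + 'C(k, (k + j.+1)./2))%N.
Proof. by rewrite /top_binomials big_ord_recr. Qed.

(** Pascal's rule; the recursion has the shape of the walk which moves [j] up or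
    down by one with each new sign, as used in [avg_unit_count]. *)
Lemma top_binomialsS (k j : nat) :
  top_binomials k.+1 j.+1 = (top_binomials k j.+2 + top_binomials k j)%N.
Proof.
elim: j => [|j IH].
  rewrite !top_binomials_recr !top_binomials0 !add0n addn0.
  have -> : ((k.+1 + 1)./2 = k./2.+1)%N by lia.
  have -> : ((k + 2)./2 = k./2.+1)%N by lia.
  rewrite binS addnC; congr (_ + _)%N.
  by rewrite -bin_sub; last lia; congr 'C(_, _); lia.
rewrite top_binomials_recr IH [in RHS]top_binomials_recr.
rewrite [X in (_ = _ + X)%N]top_binomials_recr.
have -> : ((k.+1 + j.+2)./2 = (k + j.+1)./2.+1)%N by lia.
have -> : ((k + j.+3)./2 = (k + j.+1)./2.+1)%N by lia.
by rewrite binS; lia.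
Qed.

Lemma central_binomial_double (m : nat) :
  'C(m.+1.*2, m.+1) = (2 * 'C(m.*2.+1, m))%N.
Proof.
have := mul_bin_diag m.+1.*2 m; rewrite doubleS /= => e.
by apply/eqP; rewrite -(eqn_pmul2l (ltn0Sn m)); apply/eqP; lia.
Qed.

Lemma central_binomial_even (m : nat) :
  ('C(m.*2, m) ^ 2 * m.*2.+1 <= 16 ^ m)%N.
Proof.
elim: m => [//|m IH].
have := mul_bin_down m.*2.+1 m; rewrite /= central_binomial_double.
have -> : (m.*2.+1 - m = m.+1)%N by lia.
move: 'C(m.*2, m) 'C(m.*2.+1, m) IH => x y IH e.
rewrite (expnS 16).
rewrite -(leq_pmul2l (ltn0Sn m)) -(leq_pmul2l (ltn0Sn m)).
have -> : (m.+1 * (m.+1 * ((2 * y) ^ 2 * m.+1.*2.+1)) =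
  4 * (m.+1 * y) ^ 2 * m.+1.*2.+1)%N by ring.
rewrite -e.
have H : (m.*2.+1 * m.+1.*2.+1 <= 4 * (m.+1 * m.+1))%N by nia.
have -> : (4 * (m.*2.+1 * x) ^ 2 * m.+1.*2.+1 =
  4 * (x ^ 2 * m.*2.+1 * (m.*2.+1 * m.+1.*2.+1)))%N by ring.
have -> : (m.+1 * (m.+1 * (16 * 16 ^ m)) = 4 * (16 ^ m * (4 * (m.+1 * m.+1))))%N.
  by ring.
by rewrite leq_mul2l leq_mul.
Qed.

Lemma central_binomial_le (k : nat) :
  ('C(k, k.+1./2) ^ 2 * k.+1 <= 4 ^ k)%N.
Proof.
have e16 m : (4 ^ m.*2 = 16 ^ m)%N by rewrite -mul2n expnM.
rewrite -(odd_double_half k); case: (odd k) => /=; rewrite ?add1n ?add0n.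
  have := central_binomial_even k./2.+1; rewrite central_binomial_double.
  rewrite doubleK.
  rewrite (expnS 4) e16 -[X in (X ^ 2 * _ <= 4 * _)%N]bin_sub; last lia.
  rewrite (_ : (k./2.*2.+1 - k./2.+1 = k./2)%N); last lia.
  rewrite (expnS 16); nia.
rewrite uphalf_double.
by rewrite e16 central_binomial_even.
Qed.

Lemma central_binomial_ratio (R : realType) (k : nat) :
  'C(k, k.+1./2)%:R / 2 ^+ k <= (Num.sqrt k.+1%:R)^-1 :> R.
Proof.
rewrite ler_pdivrMr ?exprn_gt0 // mulrC ler_pdivlMr ?sqrtr_gt0 //.
rewrite -ler_sqr ?nnegrE ?mulr_ge0 ?exprn_ge0 // exprMn sqr_sqrtr //.
by rewrite -!natrX -natrM ler_nat -expnM [(k * 2)%N]mulnC expnM central_binomial_le.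
Qed.

Section littlewood_offord.
Context (R : realType) (I : finType) (c : I -> R) (tau : R) (tau_gt0 : 0 < tau).

(** A list sorted by [separated] stands for the disjoint half-open intervals
    [[x, x + 2 * tau)], from right to left. *)
Definition separated (x y : R) : bool := y + 2 * tau <= x.

Lemma separated_shift (a : R) (U : seq R) :
  sorted separated U -> sorted separated [seq x + a | x <- U].
Proof.
apply: homo_sorted => x y; rewrite /separated; lra.
Qed.

Definition unit_count (U : seq R) (y : R) : R :=
  \sum_(x <- U) (x <= y < x + 2 * tau)%R%:R.

Lemma separated_disjoint (U : seq R) (y : R) :
  sorted separated U ->
  unit_count U y <= (U != [::])%:R.
Proof.
rewrite /unit_count; elim: U => [|x U IH] /= => [_|Us]; first by rewrite big_nil.
rewrite big_cons; case: (boolP (x <= y < x + 2 * tau)) => [/andP[xy _]|_]; last first.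
  rewrite add0r; apply: (le_trans (IH (path_sorted Us))).
  by case: U {IH Us}.
rewrite big_seq big1 ?addr0 // => z zU.
have /allP/(_ _ zU) : all (separated x) U.
  apply: order_path_min Us => a b e; rewrite /separated.
  by move: tau_gt0; lra.
by rewrite /separated => zx; apply/eqP; rewrite pnatr_eq0 eqb0; apply/negP; lra.
Qed.

Lemma unit_count_cons x U y :
  unit_count (x :: U) y = (x <= y < x + 2 * tau)%R%:R + unit_count U y.
Proof. by rewrite /unit_count big_cons. Qed.

Lemma unit_count_shift a U y :
  unit_count U (y + a) = unit_count [seq x - a | x <- U] y.
Proof.
rewrite /unit_count big_map; apply: eq_bigr => x _; congr (nat_of_bool _)%:R.
by apply/idP/idP; lra.
Qed.

(** Erdos's bound, for any family of disjoint intervals of length [2 * tau]: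
    with [k] coefficients of size at least [tau], the sum of the signed
    coefficients falls in the family with probability at most
    [top_binomials k j / 2 ^ k], [j] being the number of intervals.  A new
    coefficient [c j] averages the bounds for two translates of the family, which
    differ by [2 * c j]; if [`|c j| >= tau], moving the rightmost interval of one
    translate to the other leaves two families of disjoint intervals, with one
    interval more and one interval less. *)
Lemma avg_unit_count (s : seq I) (U : seq R) : uniq s -> sorted separated U ->
  let k := count (fun i => tau <= `|c i|) s in
  avg (fun v => unit_count U (\sum_(i <- s) c i * (-1) ^+ v i)) <=
  (top_binomials k (size U))%:R / 2 ^+ k.
Proof.
elim: s U => [|j s IH] U /=.
  move=> _ Us; under eq_avg do rewrite big_nil.
  rewrite avg_const expr0 divr1; apply: (le_trans (separated_disjoint 0 Us)).
  case: U {Us} => // x U; rewrite ler_nat /= /top_binomials.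
  by rewrite big_ord_recl.
case/andP=> js us Us; rewrite avg_signs_cons //.
set k := count (fun i => tau <= `|c i|) s.
set S := fun v : {ffun I -> bool} => \sum_(i <- s) c i * (-1) ^+ v i.
case: (boolP (tau <= `|c j|)) => [cj|_]; last first.
  rewrite add0n.
  under eq_avg do rewrite unit_count_shift.
  under [X in _ + X]eq_avg do rewrite unit_count_shift.
  rewrite ler_pdivrMr // mulr2n mulrDr mulr1.
  have h1 := IH _ us (separated_shift (- c j) Us).
  have h2 := IH _ us (separated_shift (- - c j) Us).
  by rewrite !size_map in h1 h2; apply: lerD.
(* The two translates play symmetric roles, so the sign of c j is irrelevant. *)
set a := `|c j| in cj.
have -> : avg (fun v => unit_count U (S v + c j)) + avg (fun v => unit_count U (S v - c j))
   = avg (fun v => unit_count U (S v + a)) + avg (fun v => unit_count U (S v - a)).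
  by rewrite /a; case: (ger0P (c j)) => // _; rewrite opprK addrC.
rewrite -avgD; case: U Us => [_|x U Us].
  under eq_avg do rewrite /unit_count !big_nil addr0.
  by rewrite avg_const mul0r divr_ge0 ?exprn_ge0.
(* x + a is the rightmost interval, taken from the family translated by a. *)
have -> : avg (fun v => unit_count (x :: U) (S v + a) + unit_count (x :: U) (S v - a))
  = avg (fun v => unit_count (x + a :: [seq y - a | y <- x :: U]) (S v)) +
    avg (fun v => unit_count [seq y - - a | y <- U] (S v)).
  rewrite -avgD; apply: eq_avg => v.
  rewrite [unit_count (x :: U) (S v - a)]unit_count_cons.
  rewrite [unit_count (x + a :: _) _]unit_count_cons unit_count_shift.
  rewrite (unit_count_shift (- a)) addrCA addrA.
  by congr (_ + _ + _); congr (nat_of_bool _)%:R; apply/idP/idP; lra.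
have s1 : sorted separated (x + a :: [seq y - a | y <- x :: U]).
  rewrite /= {1}/separated -[path _ _ _]/(sorted separated [seq y - a | y <- x :: U]).
  by rewrite separated_shift // andbT; lra.
have s2 : sorted separated [seq y - - a | y <- U].
  by apply: separated_shift; move: Us => /path_sorted.
have h1 := IH _ us s1; have h2 := IH _ us s2; rewrite /= !size_map in h1 h2.
rewrite add1n exprS top_binomialsS natrD invfM (mulrC 2^-1) mulrA.
by rewrite ler_pM2r ?invr_gt0 // mulrDl lerD.
Qed.

(** The interval [[x - t, x + t]] is covered by at most [t / tau + 1] half-open
    intervals of length [2 * tau], and one such interval is hit with probability
    at most the normalised central binomial coefficient. *)
Lemma littlewood_offord (x t : R) : 0 <= t ->
  avg (fun v => (`|\sum_i c i * (-1) ^+ v i - x| <= t)%R%:R : R) <=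
  (t / tau + 1) / Num.sqrt #|[pred i | tau <= `|c i|]|.+1%:R.
Proof.
have tau0 := tau_gt0; set k := #|_|; move=> t0; pose J := (Num.truncn (t / tau)).+1.
have tJ : t < tau * J%:R.
  by rewrite mulrC -ltr_pdivrMr // truncnS_gt.
have Jt : J%:R <= t / tau + 1.
  by rewrite /J -natr1 lerD2r truncn_le divr_ge0 // ltW.
pose y0 j := x - t + j%:R * (2 * tau).
apply: (@le_trans _ _ (\sum_(j < J) avg (fun v =>
    unit_count [:: y0 j] (\sum_i c i * (-1) ^+ v i)))).
  rewrite -avg_sum; apply: ler_avg => v; set S := \sum_i _.
  case: (boolP (`|S - x| <= t)) => [/[dup] St|_]; last first.
    by apply: sumr_ge0 => j _; apply: sumr_ge0.
  rewrite ler_norml => /andP[S1 S2].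
  pose z := (S - x + t) / (2 * tau).
  have z0 : 0 <= z by rewrite divr_ge0; lra.
  have zz := truncn_itv z0.
  have zJ : (Num.truncn z < J)%N.
    rewrite -(ltr_nat R); apply: le_lt_trans (_ : z < _).
      by move: zz => /andP[].
    rewrite ltr_pdivrMr; last lra.
    by lra.
  rewrite (bigD1 (Ordinal zJ)) //= /unit_count big_seq1 /y0 /=.
  have -> : x - t + (Num.truncn z)%:R * (2 * tau) <= S <
      x - t + (Num.truncn z)%:R * (2 * tau) + 2 * tau.
    have eS : S = x - t + z * (2 * tau).
      by rewrite /z divfK; [ring | apply/eqP; lra].
    move: zz => /andP[z1 z2]; rewrite {}eS lerD2l ler_pM2r ?mulr_gt0 // z1 /=.
    rewrite -!addrA !ltrD2l -[X in _ + X]mul1r -mulrDl ltr_pM2r ?mulr_gt0 //.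
    by rewrite natr1.
  by rewrite lerDl; apply: sumr_ge0 => j _; apply: sumr_ge0.
apply: le_trans (_ : \sum_(j < J) (Num.sqrt k.+1%:R)^-1 <= _).
  apply: ler_sum => j _; apply: le_trans (avg_unit_count _ _) _ => //.
    exact: index_enum_uniq.
  have -> : count (fun i => tau <= `|c i|) (index_enum I) = k.
    by rewrite /k cardE /enum_mem size_filter; apply: eq_count.
  apply: le_trans (central_binomial_ratio R k); rewrite /= top_binomials_recr.
  by rewrite top_binomials0 addn1.
by rewrite sumr_const card_ord -[leLHS]mulr_natl ler_pM2r // invr_gt0 sqrtr_gt0.
Qed.

End littlewood_offord.

(** * Concentration and anticoncentration of sums of signs *)

Section sign_sums.
Context (R : realType) (I : finType).
Implicit Types (s : seq I) (v : {ffun I -> bool}).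

Lemma avg_sum_cons (h : R -> R) (j : I) s : j \notin s ->
  avg (fun v => h (\sum_(i <- j :: s) (-1) ^+ v i)) =
  avg (fun v => (h (\sum_(i <- s) (-1) ^+ v i + 1) +
                 h (\sum_(i <- s) (-1) ^+ v i - 1)) / 2).
Proof.
move=> js; have := avg_signs_cons (fun=> 1) h js.
have E (r : seq I) v : \sum_(i <- r) 1 * (-1) ^+ v i = \sum_(i <- r) (-1) ^+ v i :> R.
  by under eq_bigr do rewrite mul1r.
under eq_avg do rewrite E.
move=> ->; rewrite -avgD mulrC -avgZ; apply: eq_avg => v.
by rewrite !E mulrC.
Qed.

Lemma second_moment s : uniq s ->
  avg (fun v => (\sum_(i <- s) (-1) ^+ v i) ^+ 2) = (size s)%:R :> R.
Proof.
elim: s => [_|j s IH /= /andP[js us]].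
  by under eq_avg do rewrite big_nil expr0n; rewrite avg_const.
rewrite (avg_sum_cons (fun y => y ^+ 2) js) -[(size s).+1%:R]natr1 -IH //.
rewrite -[X in _ = _ + X](@avg_const _ I).
by rewrite -avgD; apply: eq_avg => v; field.
Qed.

Lemma fourth_moment s : uniq s ->
  avg (fun v => (\sum_(i <- s) (-1) ^+ v i) ^+ 4) <= 3 * (size s)%:R ^+ 2 :> R.
Proof.
elim: s => [_|j s IH /= /andP[js us]].
  by under eq_avg do rewrite big_nil expr0n; rewrite avg_const expr0n mulr0.
rewrite (avg_sum_cons (fun y => y ^+ 4) js).
rewrite (_ : avg _ = avg (fun v => (\sum_(i <- s) (-1) ^+ v i) ^+ 4) + 6 * (size s)%:R + 1).
  by rewrite -[(size s).+1%:R]natr1; have := IH us; lra.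
rewrite -second_moment // -avgZ -[X in _ = _ + X](@avg_const _ I) -!avgD.
by apply: eq_avg => v; field.
Qed.

(** For [x < 1 / 2] the two exponentials are bounded by [(1 - x)^-1] and
    [(1 + x)^-1], whose mean is [(1 - x ^+ 2)^-1]; for larger [x] the bound by
    [expR x] is enough. *)
Lemma cosh_le (x : R) : (expR x + expR (- x)) / 2 <= expR (2 * x ^+ 2).
Proof.
wlog x0 : x / 0 <= x.
  move=> H; have [x0|x0] := leP 0 x; first exact: H.
  have := H (- x); rewrite opprK sqrrN addrC; apply.
  by rewrite oppr_ge0 ltW.
have [x2|x2] := leP (1 / 2) x.
  apply: le_trans (_ : expR x <= _); last by rewrite ler_expR; nra.
  have : expR (- x) <= expR x by rewrite ler_expR; lra.
  by lra.
have e1 : expR x <= (1 - x)^-1.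
  rewrite -[expR x]invrK -expRN lef_pV2 ?posrE ?expR_gt0 //; last lra.
  exact: expR_ge1Dx.
have e2 : expR (- x) <= (1 + x)^-1.
  rewrite expRN lef_pV2 ?posrE ?expR_gt0 //; last lra.
  exact: expR_ge1Dx.
apply: le_trans (_ : 1 + 2 * x ^+ 2 <= _); last exact: expR_ge1Dx.
have -> : 1 + 2 * x ^+ 2 = ((1 - x)^-1 + (1 + x)^-1) / 2 +
    x ^+ 2 * (1 - 2 * x ^+ 2) / ((1 - x) * (1 + x)).
  by field; apply/andP; split; lra.
apply: le_trans (_ : ((1 - x)^-1 + (1 + x)^-1) / 2 <= _); first by lra.
rewrite lerDl divr_ge0 ?mulr_ge0 ?sqr_ge0 //; nra.
Qed.

Lemma exponential_moment s (lam : R) : uniq s ->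
  avg (fun v => expR (lam * \sum_(i <- s) (-1) ^+ v i)) <=
  expR (2 * lam ^+ 2 * (size s)%:R).
Proof.
elim: s => [_|j s IH /= /andP[js us]].
  under eq_avg do rewrite big_nil mulr0 expR0.
  by rewrite avg_const mulr0 expR0.
rewrite (avg_sum_cons (fun y => expR (lam * y)) js).
rewrite -[(size s).+1%:R]natr1 [2 * _ * (_ + _)]mulrDr mulr1 expRD.
under eq_avg => v.
  rewrite [lam * (_ + 1)]mulrDr [lam * (_ - 1)]mulrDr mulrN !mulr1 !expRD.
  rewrite -mulrDr -mulrA mulrC; over.
rewrite avgZ mulrC ler_pM ?avg_ge0 ?cosh_le ?IH //.
Qed.

Lemma sum_tail s (L : R) : uniq s -> (0 < size s)%N -> 0 <= L ->
  avg (fun v => (L * Num.sqrt (size s)%:R < `|\sum_(i <- s) (-1) ^+ v i|)%R%:R : R)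
  <= 2 * expR (- (L ^+ 2 / 8)).
Proof.
move=> us s0 L0; set q := Num.sqrt _.
have q0 : 0 < q by rewrite sqrtr_gt0 ltr0n.
have q2 : (size s)%:R = q ^+ 2 by rewrite sqr_sqrtr.
(* The minimiser of - lam * (L * q) + 2 * lam ^+ 2 * q ^+ 2. *)
pose lam := L / (4 * q).
have lam0 : 0 <= lam by rewrite divr_ge0 // mulr_ge0 // ltW.
pose S v : R := \sum_(i <- s) (-1) ^+ v i.
apply: (@le_trans _ _ (expR (- (lam * (L * q))) *
    (avg (fun v => expR (lam * S v)) + avg (fun v => expR (- lam * S v))))).
  rewrite -avgD -avgZ; apply: ler_avg => v; rewrite -/(S v) mulrDr -!expRD.
  case: ltP => [SL|_]; last by rewrite addr_ge0 ?expR_ge0.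
  have [S0|S0] := leP 0 (S v).
    rewrite -[1%:R]addr0 lerD ?expR_ge0 // -expR0 ler_expR.
    by move: SL; rewrite ger0_norm // => SL; nra.
  rewrite -[1%:R]add0r lerD ?expR_ge0 // -expR0 ler_expR.
  by move: SL; rewrite ltr0_norm // => SL; nra.
have m1 := exponential_moment lam us; have m2 := exponential_moment (- lam) us.
rewrite sqrrN in m2.
apply: le_trans (_ : expR (- (lam * (L * q))) *
  (2 * expR (2 * lam ^+ 2 * (size s)%:R)) <= _).
  by rewrite ler_pM2l ?expR_gt0 // mulrDl !mul1r lerD.
rewrite mulrCA -expRD ler_pM2l // ler_expR q2 /lam le_eqVlt; apply/orP; left.
by apply/eqP; field; rewrite gt_eqF.
Qed.

(** A Paley-Zygmund estimate: the polynomial [(- z ^+ 2 + 8 * z - 2) / 16] is at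
    most 1, and is nonpositive for [0 <= z <= 1 / 4]; the first two moments of
    [z = S ^+ 2 / size s] bound its mean from below. *)
Lemma sum_anticoncentration s : uniq s -> (0 < size s)%N ->
  3 / 16 <= avg (fun v =>
    (Num.sqrt (size s)%:R / 2 <= `|\sum_(i <- s) (-1) ^+ v i| :> R)%R%:R : R).
Proof.
move=> us s0; set q := Num.sqrt _.
have q0 : 0 < q by rewrite sqrtr_gt0 ltr0n.
have q2 : (size s)%:R = q ^+ 2 by rewrite sqr_sqrtr.
pose S v : R := \sum_(i <- s) (-1) ^+ v i.
apply: (@le_trans _ _ (avg (fun v => (- (16 * q ^+ 4)^-1) * S v ^+ 4 +
   (2 * q ^+ 2)^-1 * S v ^+ 2 + - (1 / 8)))).
  rewrite avgD avg_const avgD !avgZ second_moment // q2.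
  have := fourth_moment us; rewrite q2 -exprM => m4.
  have : - (16 * q ^+ 4)^-1 * (3 * q ^+ 4) <=
         - (16 * q ^+ 4)^-1 * avg (fun v => S v ^+ 4).
    by rewrite ler_wnM2l // oppr_le0 invr_ge0 mulr_ge0 // exprn_ge0 // ltW.
  have -> : - (16 * q ^+ 4)^-1 * (3 * q ^+ 4) = - (3 / 16).
    by field; rewrite gt_eqF.
  have -> : (2 * q ^+ 2)^-1 * q ^+ 2 = 1 / 2 by field; rewrite gt_eqF.
  by lra.
apply: ler_avg => v; rewrite -/(S v); pose z := (S v / q) ^+ 2.
have -> : - (16 * q ^+ 4)^-1 * S v ^+ 4 + (2 * q ^+ 2)^-1 * S v ^+ 2 + - (1 / 8)
  = (- z ^+ 2 + 8 * z - 2) / 16 by rewrite /z; field; rewrite gt_eqF.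
case: (leP (q / 2)) => Sq; first by have := sqr_ge0 (z - 4); rewrite /=; nra.
have z0 : 0 <= z by rewrite sqr_ge0.
have z1 : z <= 1 / 4.
  rewrite /z -real_normK ?num_real // normrM normfV (gtr0_norm q0).
  have : `|S v| / q <= 1 / 2 by rewrite ler_pdivrMr //; lra.
  have : 0 <= `|S v| / q by rewrite divr_ge0 // ltW.
  by nra.
by have := sqr_ge0 z; rewrite /=; lra.
Qed.

End sign_sums.

(** * Increments of powers and products *)

Section power_increments.
Context (R : realType).

(** Convexity: among increments with a given sum, a single large one moves the
    power most. *)
Lemma pow_superadditive (M x y : R) (d : nat) : 0 <= M -> 0 <= x -> 0 <= y ->
  (M + x) ^+ d + (M + y) ^+ d <= (M + (x + y)) ^+ d + M ^+ d.
Proof.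
move=> M0 x0 y0; elim: d => [|d IH]; first by rewrite !expr0.
rewrite !exprS.
have h1 : (M + x) ^+ d <= (M + (x + y)) ^+ d by rewrite lerXn2r ?nnegrE; lra.
have h2 : (M + y) ^+ d <= (M + (x + y)) ^+ d by rewrite lerXn2r ?nnegrE; lra.
by nra.
Qed.

Lemma sum_pow_increments (A : finType) (M : R) (e : A -> R) (d : nat) :
  0 <= M -> (forall a, 0 <= e a) ->
  \sum_a ((M + e a) ^+ d - M ^+ d) <= (M + \sum_a e a) ^+ d - M ^+ d.
Proof.
move=> M0 e0; elim: (index_enum A) => [|a r IH].
  by rewrite !big_nil addr0 subrr.
rewrite !big_cons.
have r0 : 0 <= \sum_(b <- r) e b by rewrite sumr_ge0.
by have := pow_superadditive d M0 (e0 a) r0; lra.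
Qed.

(** Expanding both products, every term of the difference contains some
    [y s - x s] and is dominated by the matching term in [M] and [e]. *)
Lemma prod_perturbation (S : finType) (M : R) (x y e : S -> R) : 0 <= M ->
  (forall s, `|x s| <= M) -> (forall s, `|y s - x s| <= e s) ->
  `|\prod_s y s - \prod_s x s| <= (M + \sum_s e s) ^+ #|S| - M ^+ #|S|.
Proof.
move=> M0 xM ye.
have e0 s : 0 <= e s := le_trans (normr_ge0 _) (ye s).
apply: (@le_trans _ _ (\prod_s (M + e s) - \prod_(s : S) M)); last first.
  rewrite prodr_const lerD2r -prodr_const; apply: ler_prod => s _.
  rewrite addr_ge0 //= lerD2l (bigD1 s) //= lerDl sumr_ge0 //.
suff [_] : `|\prod_s x s| <= \prod_(s : S) M /\
   `|\prod_s y s - \prod_s x s| <= \prod_s (M + e s) - \prod_(s : S) M by [].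
elim: (index_enum S) => [|s r [IH1 IH2]].
  by rewrite !big_nil; split; [rewrite normr1 | rewrite subrr normr0].
rewrite !big_cons; split; first by rewrite normrM ler_pM.
set Y := \prod_(s <- r) y s in IH2 *; set X := \prod_(s <- r) x s in IH1 IH2 *.
have -> : y s * Y - x s * X = y s * (Y - X) + (y s - x s) * X by ring.
have yM : `|y s| <= M + e s.
  have -> : y s = x s + (y s - x s) by ring.
  by apply: le_trans (ler_normD _ _) _; rewrite lerD.
apply: le_trans (ler_normD _ _) _; rewrite !normrM.
apply: le_trans (lerD (ler_pM (normr_ge0 _) (normr_ge0 _) yM IH2)
  (ler_pM (normr_ge0 _) (normr_ge0 _) (ye s) IH1)) _.
by rewrite le_eqVlt; apply/orP; left; apply/eqP; ring.
Qed.

End power_increments.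

(** * The block-diagonal form *)

(** Coordinates are indexed by an arbitrary finite type [I], each coordinate
    having a row and a block; the cells, where a row meets a block, all have [w]
    coordinates. *)
Section blocks.
Context (R : realType) (I Rw A : finType) (row : I -> Rw) (blk : I -> A) (w : nat).
Context (w_gt0 : (0 < w)%N).
Context (cell_card : forall s a, #|[pred i | (row i == s) && (blk i == a)]| = w).
Implicit Types (v u : {ffun I -> bool}).

Definition cell_sum s a v : R :=
  \sum_(i | (row i == s) && (blk i == a)) (-1) ^+ v i.

Definition block_form v : R := \sum_a \prod_s cell_sum s a v.

Let cell s a := [seq i <- index_enum I | (row i == s) && (blk i == a)].

Let cell_uniq s a : uniq (cell s a).
Proof. by rewrite filter_uniq // index_enum_uniq. Qed.

Let size_cell s a : size (cell s a) = w.
Proof. by rewrite -(cell_card s a) cardE /enum_mem; congr size; apply: eq_filter. Qed.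

Let cell_sumE s a v : cell_sum s a v = \sum_(i <- cell s a) (-1) ^+ v i.
Proof. by rewrite big_filter. Qed.

Lemma cell_sum_tail s a (L : R) : 0 <= L ->
  avg (fun v => (L * Num.sqrt w%:R < `|cell_sum s a v|)%R%:R : R)
  <= 2 * expR (- (L ^+ 2 / 8)).
Proof.
move=> L0; have := sum_tail (cell_uniq s a) _ L0; rewrite size_cell => /(_ w_gt0).
by under eq_avg do rewrite -cell_sumE.
Qed.

Definition large s a v : bool := Num.sqrt w%:R / 2 <= `|cell_sum s a v|.

Lemma avg_large s a : 3 / 16 <= avg (fun v => (large s a v)%:R : R).
Proof.
have := sum_anticoncentration R (cell_uniq s a); rewrite size_cell => /(_ w_gt0).
by under eq_avg do rewrite -cell_sumE.
Qed.

Lemma eq_cell_sum s a u v : (forall i, row i = s -> blk i = a -> u i = v i) ->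
  cell_sum s a u = cell_sum s a v.
Proof.
by move=> uv; apply: eq_bigr => i /andP[/eqP ris /eqP bia]; rewrite uv.
Qed.

Context (s0 : Rw).

Definition all_large a v : bool := [forall (s | s != s0), large s a v].

Definition good_blocks v : {set A} := [set a | all_large a v].

Definition good_proba : R := (3 / 16) ^+ #|Rw|.-1.

Lemma good_proba_gt0 : 0 < good_proba.
Proof. by rewrite exprn_gt0 // divr_gt0. Qed.

Lemma avg_all_large a : good_proba <= avg (fun v => (all_large a v)%:R : R).
Proof.
rewrite (@eq_avg _ _ _ (fun v => \prod_(s | s != s0) (large s a v)%:R)).
  rewrite (avg_prod (key := row)).
    rewrite /good_proba -(cardC1 s0) -prodr_const; apply: ler_prod => s _.
    by rewrite avg_large divr_ge0.
  by move=> s u v uv; rewrite /large (@eq_cell_sum _ _ u v) // => i /uv.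
move=> v; case: (boolP (all_large a v)); rewrite /all_large.
  by move=> /forall_inP ga; rewrite big1 // => s ss0; rewrite ga.
by rewrite negb_forall_in => /existsP[s /andP[ss0 /negbTE lf]]; rewrite (bigD1 s) //= lf mul0r.
Qed.

(** Chernoff's method, applied to [expR (- N)] where [N] is the number of good
    blocks: a block multiplies the mean of [expR (- N)] by at most
    [1 - good_proba / 2], since [expR (-1) <= 1 / 2]. *)
Lemma few_good_blocks :
  avg (fun v => (#|good_blocks v|%:R < good_proba / 4 * #|A|%:R)%R%:R : R) <=
  expR (- (good_proba / 4 * #|A|%:R)).
Proof.
set p := good_proba; have p0 : 0 < p := good_proba_gt0.
set k := p / 4 * #|A|%:R.
pose g a v : R := expR (- (all_large a v)%:R).
apply: (@le_trans _ _ (expR k * avg (fun v => \prod_a g a v))).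
  rewrite -avgZ; apply: ler_avg => v.
  have -> : \prod_a g a v = expR (- #|good_blocks v|%:R).
    rewrite -expR_sum sumrN; congr (expR (- _)).
    rewrite -sum1_card natr_sum [RHS]big_mkcond /=; apply: eq_bigr => a _.
    by rewrite inE; case: all_large.
  rewrite -expRD; case: (ltP _ k) => [H|_]; last exact: expR_ge0.
  by apply: le_trans (_ : expR 0 <= _); [rewrite expR0 | rewrite ler_expR subr_ge0 ltW].
have -> : avg (fun v => \prod_a g a v) = \prod_a avg (g a).
  apply: (avg_prod (key := blk)).
  move=> a u v uv; rewrite /g /all_large; congr (expR (- (nat_of_bool _)%:R)).
  apply: eq_forallb => s; rewrite /large (@eq_cell_sum _ _ u v) // => i _; exact: uv.
have e1 : expR (-1) <= 1 / 2 :> R.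
  rewrite expRN div1r lef_pV2 ?posrE ?expR_gt0 //.
  by have := expR_ge1Dx (1 : R); lra.
apply: le_trans (_ : expR k * \prod_(a : A) expR (- (p / 2)) <= _).
  rewrite ler_pM2l ?expR_gt0 //; apply: ler_prod => a _.
  rewrite avg_ge0 => [|v]; last exact: expR_ge0.
  apply: le_trans (expR_ge1Dx _).
  rewrite (@eq_avg _ _ _ (fun v => - (1 - expR (-1)) * (all_large a v)%:R + 1)).
    by rewrite avgD avg_const avgZ /=; have := avg_all_large a; rewrite -/p; nra.
  by move=> v; rewrite /g; case: all_large; rewrite ?oppr0 ?expR0 /=; ring.
rewrite prodr_const -expRM_natl -expRD ler_expR /k -mulr_natl; lra.
Qed.

(** By superadditivity of the increments of powers, the worst case is that of [r]
    changes in a single cell. *)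
Lemma block_form_perturbation u v (M : R) (r : nat) : 0 <= M ->
  (forall s a, `|cell_sum s a u| <= M) ->
  (#|[pred i | u i != v i]| <= r)%N ->
  `|block_form v - block_form u| <= (M + 2 * r%:R) ^+ #|Rw| - M ^+ #|Rw|.
Proof.
move=> M0 uM uv.
pose e s a : R := \sum_(i | (row i == s) && (blk i == a)) 2 * (u i != v i)%:R.
have e0 s a : 0 <= e s a by rewrite sumr_ge0 // => i _; rewrite mulr_ge0.
have ve s a : `|cell_sum s a v - cell_sum s a u| <= e s a.
  rewrite -sumrB; apply: le_trans (ler_norm_sum _ _ _) _; apply: ler_sum => i _.
  case: (eqVneq (u i) (v i)) => [->|_]; first by rewrite subrr normr0 mulr0.
  by apply: le_trans (ler_normB _ _) _; rewrite !normr_sign mulr1.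
rewrite -sumrB; apply: le_trans (ler_norm_sum _ _ _) _.
apply: (@le_trans _ _ (\sum_a ((M + \sum_s e s a) ^+ #|Rw| - M ^+ #|Rw|))).
  by apply: ler_sum => a _; apply: prod_perturbation.
apply: le_trans (sum_pow_increments _ M0 _) _; first by move=> a; rewrite sumr_ge0.
have se : \sum_a \sum_s e s a <= 2 * r%:R.
  have -> : \sum_a \sum_s e s a = \sum_i 2 * (u i != v i)%:R.
    rewrite exchange_big /= (partition_big row xpredT) //=; apply: eq_bigr => s _.
    by rewrite [RHS](partition_big blk xpredT).
  rewrite -mulr_sumr ler_pM2l // -natr_sum ler_nat; apply: leq_trans uv.
  by rewrite -sum1_card [leqRHS]big_mkcond.
rewrite lerD2r lerXn2r ?nnegrE ?addr_ge0 ?lerD2l //.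
  by rewrite sumr_ge0 // => a _; rewrite sumr_ge0.
Qed.

Definition other_rows_prod a u : R := \prod_(s | s != s0) cell_sum s a u.

Lemma cell_sum_mix s a u v :
  cell_sum s a (mix (fun i => row i == s0) u v) =
  cell_sum s a (if s == s0 then v else u).
Proof.
by case: ifP => ss0; apply: eq_cell_sum => i ris _; rewrite ffunE ris ss0.
Qed.

(** With the other rows fixed, the form is linear in the signs of row [s0]. *)
Lemma block_form_mix u v :
  block_form (mix (fun i => row i == s0) u v) =
  \sum_i (if row i == s0 then other_rows_prod (blk i) u else 0) * (-1) ^+ v i.
Proof.
rewrite (bigID (fun i => row i == s0)) /= [X in _ = _ + X]big1 ?addr0; last first.
  by move=> i /negbTE ->; rewrite mul0r.
rewrite (partition_big blk xpredT) //=; apply: eq_bigr => a _.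
rewrite (bigD1 s0) //= cell_sum_mix eqxx mulrC mulr_sumr.
apply: eq_bigr => i /andP[/eqP -> /eqP ->]; rewrite eqxx; congr (_ * _).
by apply: eq_bigr => s /negbTE ss0; rewrite cell_sum_mix ss0.
Qed.

Lemma good_blocks_mix u v :
  good_blocks (mix (fun i => row i == s0) u v) = good_blocks u.
Proof.
apply/setP => a; rewrite !inE /all_large; apply: eq_forallb => s.
by rewrite /large cell_sum_mix; case: (s == s0).
Qed.

Lemma good_blocks_card u :
  (w * #|good_blocks u| <= #|[pred i | ((Num.sqrt w%:R / 2) ^+ #|Rw|.-1 <=
     `|if row i == s0 then other_rows_prod (blk i) u else 0|)%R]|)%N.
Proof.
rewrite -sum1_card big_distrr /= muln1.
apply: (@leq_trans (\sum_(i | (row i == s0) && (blk i \in good_blocks u)) 1)%N).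
  rewrite [leqRHS](partition_big blk (mem (good_blocks u))) /=; last first.
    by move=> i /andP[].
  apply: leq_sum => a ga; rewrite -[leqLHS](cell_card s0 a) -sum1_card.
  rewrite leq_eqVlt; apply/orP; left; apply/eqP; apply: eq_bigl => i /=.
  move: ga; rewrite !inE; case: (row i == s0) => //=.
  by move=> ga; case: eqP => [->|_]; rewrite ?ga ?andbF.
rewrite sum1_card; apply: subset_leq_card; apply/fintype.subsetP => i.
rewrite unfold_in => /andP[ri]; rewrite inE => /forall_inP gi; rewrite inE ri.
rewrite normr_prod -(cardC1 s0) -prodr_const; apply: ler_prod => s ss0.
by rewrite divr_ge0 ?sqrtr_ge0 //=; apply: gi.
Qed.

(** Every good block contributes [w] coefficients of size at least
    [(sqrt w / 2) ^ (#|Rw| - 1)] to the linear form of [block_form_mix]. *)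
Lemma small_ball_given_good_blocks u (x t : R) : 0 <= t ->
  good_proba / 4 * #|A|%:R <= #|good_blocks u|%:R -> (0 < #|A|)%N ->
  avg (fun v => (`|block_form (mix (fun i => row i == s0) u v) - x| <= t)%R%:R : R)
  <= (t / (Num.sqrt w%:R / 2) ^+ #|Rw|.-1 + 1) *
     (2 / Num.sqrt (good_proba * (#|A| * w)%:R)).
Proof.
move=> t0 gu A0; under eq_avg do rewrite block_form_mix.
have tau0 : 0 < (Num.sqrt w%:R / 2) ^+ #|Rw|.-1 :> R.
  by rewrite exprn_gt0 // divr_gt0 // sqrtr_gt0 ltr0n.
apply: le_trans (littlewood_offord _ tau0 x t0) _.
set k := #|_|; have kw := good_blocks_card u; rewrite -/k in kw.
have p0 := good_proba_gt0.
rewrite ler_pM2l ?ltr_wpDl ?divr_ge0 // ?(ltW tau0) //.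
have n0 : 0 < Num.sqrt (good_proba * (#|A| * w)%:R).
  by rewrite sqrtr_gt0 mulr_gt0 // ltr0n muln_gt0 A0.
rewrite ler_pdivlMr // mulrC ler_pdivrMr ?sqrtr_gt0 ?ltr0n //.
rewrite -ler_sqr ?nnegrE ?mulr_ge0 ?sqrtr_ge0 // exprMn !sqr_sqrtr ?mulr_ge0 ?(ltW p0) //.
have kw' : w%:R * #|good_blocks u|%:R <= k%:R :> R by rewrite -natrM ler_nat.
have w0 : 0 < w%:R :> R by rewrite ltr0n.
have : w%:R * (good_proba / 4 * #|A|%:R) <= w%:R * #|good_blocks u|%:R.
  by rewrite ler_pM2l.
rewrite natrM -[k.+1%:R]natr1; lra.
Qed.

(** If [Q u] only holds when the level set of [x] is within distance [r] of [u],
    then a point of [Q] has a large cell sum, or few good blocks, or a value within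
    [t] of [x]; the last case is treated by resampling row [s0], which does not
    change the good blocks. *)
Lemma block_resilience (x L : R) (r : nat) (Q : {ffun I -> bool} -> bool) :
  2 <= L -> (0 < #|A|)%N ->
  (forall u, Q u -> exists2 v : {ffun I -> bool}, (#|[pred i | u i != v i]| <= r)%N &
     block_form v = x) ->
  avg (fun u => (Q u)%:R) <=
    2 * #|Rw|%:R * #|A|%:R * expR (- (L ^+ 2 / 8)) +
    expR (- (good_proba / 4 * #|A|%:R)) +
    (2 ^+ #|Rw|.-1 * L ^+ #|Rw| * Num.sqrt w%:R *
       ((1 + r%:R / Num.sqrt w%:R) ^+ #|Rw| - 1) + 1) *
    (2 / Num.sqrt (good_proba * (#|A| * w)%:R)).
Proof.
move=> L2 A0 Qr; set q := Num.sqrt w%:R; set G := _ ^+ _ - 1.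
have q0 : 0 < q by rewrite sqrtr_gt0 ltr0n.
have L0 : 0 <= L by lra.
pose t := L ^+ #|Rw| * q ^+ #|Rw| * G.
have G0 : 0 <= G by rewrite subr_ge0 exprn_ege1 // lerDl divr_ge0 // ltW.
have t0 : 0 <= t by rewrite !mulr_ge0 ?exprn_ge0 // ltW.
pose tall s a u : R := (L * q < `|cell_sum s a u|)%R%:R.
pose few u : bool := #|good_blocks u|%:R < good_proba / 4 * #|A|%:R.
pose near u : bool := `|block_form u - x| <= t.
apply: (@le_trans _ _ (avg (fun u => \sum_s \sum_a tall s a u + (few u)%:R +
    (~~ few u && near u)%:R))).
  apply: ler_avg => u; case Qu: (Q u); last first.
    by rewrite !addr_ge0 // sumr_ge0 // => s _; rewrite sumr_ge0.
  have [v uv vx] := Qr u Qu.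
  have [/existsP[s /existsP[a sa]]|] :=
    boolP [exists s, [exists a, L * q < `|cell_sum s a u|]].
    rewrite (bigD1 s) //= (bigD1 a) //= {1}/tall sa.
    rewrite -!addrA lerDl !addr_ge0 // sumr_ge0 // => s' _; rewrite sumr_ge0 //.
  rewrite negb_exists => /forallP tallF.
  have uM s a : `|cell_sum s a u| <= L * q.
    by have := tallF s; rewrite negb_exists => /forallP/(_ a); rewrite -leNgt.
  have -> : near u.
    rewrite /near -vx distrC.
    apply: le_trans (block_form_perturbation _ uM uv) _; first by rewrite mulr_ge0 // ltW.
    apply: (@le_trans _ _ ((L * (q + r%:R)) ^+ #|Rw| - (L * q) ^+ #|Rw|)).
      rewrite lerD2r lerXn2r ?nnegrE ?addr_ge0 ?mulr_ge0 ?addr_ge0 ?(ltW q0) //.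
      by rewrite mulrDr lerD2l ler_wpM2r.
    have -> : q + r%:R = q * (1 + r%:R / q) by field; rewrite gt_eqF.
    by rewrite /t /G !exprMn le_eqVlt; apply/orP; left; apply/eqP; ring.
  rewrite andbT; case: (few u); rewrite /= ?addr0 lerDr sumr_ge0 // => s _.
    by rewrite sumr_ge0.
  by rewrite sumr_ge0.
rewrite !avgD; apply: lerD; first apply: lerD.
- rewrite avg_sum; apply: le_trans (_ : \sum_(s : Rw) \sum_(a : A)
    2 * expR (- (L ^+ 2 / 8)) <= _).
    apply: ler_sum => s _; rewrite avg_sum; apply: ler_sum => a _.
    exact: cell_sum_tail.
  rewrite !sumr_const -[_ *+ #|A|]mulr_natl -[_ *+ #|Rw|]mulr_natl.
  by rewrite le_eqVlt; apply/orP; left; apply/eqP; ring.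
- exact: few_good_blocks.
have p0 := good_proba_gt0.
rewrite (avg_resample (fun i => row i == s0)).
set rhs := (X in _ <= X).
have rhs0 : 0 <= rhs.
  by rewrite mulr_ge0 ?divr_ge0 ?sqrtr_ge0 ?addr_ge0 ?mulr_ge0 ?exprn_ge0 ?(ltW q0).
rewrite -[leRHS](@avg_const _ I); apply: ler_avg => u.
case fu: (few u).
  under eq_avg do rewrite /few good_blocks_mix -/(few u) fu /=.
  by rewrite avg_const.
under eq_avg do rewrite /few good_blocks_mix -/(few u) fu /=.
have gu : good_proba / 4 * #|A|%:R <= #|good_blocks u|%:R by rewrite leNgt -/(few u) fu.
apply: le_trans (small_ball_given_good_blocks x t0 gu A0) _.
rewrite /rhs ler_wpM2r ?divr_ge0 ?sqrtr_ge0 // lerD2r -/q.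
have : (0 < #|Rw|)%N by apply/card_gt0P; exists s0.
rewrite /t; case: #|Rw| => // D _ /=; rewrite le_eqVlt; apply/orP; left; apply/eqP.
by rewrite !exprS expr_div_n; field; rewrite !expf_neq0 ?gt_eqF.
Qed.

End blocks.

(** * From tensors and random vectors to sign vectors *)

Section block_index.
Context (n w : nat) (wn : (w %| n)%N).

Lemma block_index_subproof (i : 'I_n) : (i %/ w < n %/ w)%N.
Proof.
have w0 : (0 < w)%N by apply: dvdn_gt0 wn; exact: leq_ltn_trans (ltn_ord i).
by rewrite ltn_divLR // divnK.
Qed.

Definition block_index (i : 'I_n) : 'I_(n %/ w) := Ordinal (block_index_subproof i).

Lemma block_indexE (w_gt0 : (0 < w)%N) (i : 'I_n) (a : 'I_(n %/ w)) :
  (block_index i == a) = (a * w <= i < a.+1 * w)%N.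
Proof. by rewrite -leq_divRL // -ltn_divLR // ltnS andbC -eqn_leq. Qed.

Lemma cell_card (d : nat) (w_gt0 : (0 < w)%N) (s : 'I_d) (a : 'I_(n %/ w)) :
  #|[pred p : 'I_d * 'I_n | (p.1 == s) && (block_index p.2 == a)]| = w.
Proof.
have lt_n (j : 'I_w) : (a * w + j < n)%N.
  rewrite -[leqRHS](divnK wn); apply: (@leq_trans (a.+1 * w)).
    by rewrite mulSn addnC ltn_add2r.
  by rewrite leq_mul2r (ltn_ord a) orbT.
pose f j := (s, Ordinal (lt_n j)).
have f_inj : injective f.
  by move=> j k [/addnI jk]; apply: val_inj.
rewrite -[RHS](card_ord w) -(fintype.card_image f_inj); apply: eq_card => -[s' i].
rewrite !inE /= block_indexE //; apply/andP/fintype.imageP.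
  move=> [/eqP -> /andP[ai ia]].
  have iw : (i - a * w < w)%N by rewrite ltn_subLR // addnC -mulSn.
  exists (Ordinal iw) => //; congr pair; apply: val_inj => /=.
  by rewrite subnKC.
move=> [j _ [-> ->]]; rewrite eqxx /= leq_addr mulSn addnC ltn_add2r ltn_ord.
by split.
Qed.

End block_index.

Section evaluation.
Context (R : realType) (d n w : nat) (wn : (w %| n)%N).
Context (w_gt0 : (0 < w)%N) (d_gt0 : (0 < d)%N).

Definition flat (u : 'I_d -> cube n) : {ffun 'I_d * 'I_n -> bool} :=
  [ffun p => u p.1 p.2].

(** All indices lie in the same block for at most one block, since [d > 0]. *)
Lemma block_tensorE (i : {ffun 'I_d -> 'I_n}) :
  @block_tensor R d n w i = \sum_a \prod_s (block_index wn (i s) == a)%:R.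
Proof.
pose s0 := Ordinal d_gt0.
rewrite /block_tensor (bigD1 (block_index wn (i s0))) //= [X in _ + X]big1 ?addr0; last first.
  by move=> a /negbTE ne; rewrite (bigD1 s0) //= eq_sym ne mul0r.
case: (boolP [exists _, _]) => [/existsP[a /forallP ia]|].
  have ia' s : block_index wn (i s) = a by apply/eqP; rewrite block_indexE // ia.
  by rewrite big1 // => s _; rewrite !ia' eqxx.
rewrite negb_exists => /forallP /(_ (block_index wn (i s0))).
rewrite negb_forall => /existsP[s]; rewrite -block_indexE // => /negbTE ne.
by rewrite (bigD1 s) //= ne mul0r.
Qed.

(** Exchanging the sum over blocks with the sum over index tuples, the latter
    factors over the rows. *)
Lemma tensor_eval_block (u : 'I_d -> cube n) :
  tensor_eval (@block_tensor R d n w) (signs R u) =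
  block_form R fst (fun p => block_index wn p.2) (flat u).
Proof.
rewrite /tensor_eval /block_form.
under eq_bigr do rewrite block_tensorE mulr_suml.
rewrite exchange_big /=; apply: eq_bigr => a _.
rewrite (eq_bigr (fun i : {ffun 'I_d -> 'I_n} =>
    \prod_s ((block_index wn (i s) == a)%:R * signs R u s (i s)))); last first.
  by move=> i _; rewrite big_split.
rewrite -(bigA_distr_bigA (fun s j => (block_index wn j == a)%:R * signs R u s j)).
apply: eq_bigr => s _; rewrite /cell_sum.
rewrite [RHS](eq_bigr (fun p => signs R u p.1 p.2)); last by move=> p _; rewrite ffunE.
rewrite -(pair_big (fun r => r == s) (fun j => block_index wn j == a) (signs R u)).
rewrite /= big_pred1_eq [RHS]big_mkcond.
by apply: eq_bigr => j _; case: eqP; rewrite ?mul1r ?mul0r.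
Qed.

Lemma hamming_flat (u v : 'I_d -> cube n) :
  #|[pred p | flat u p != flat v p]| = hamming u v.
Proof.
rewrite -sum1_card big_mkcond /hamming.
rewrite (eq_bigr (fun s => \sum_i (u s i != v s i : nat))%N).
  by rewrite pair_bigA; apply: eq_bigr => -[s i] _; rewrite inE !ffunE; case: eqP.
move=> s _; rewrite -sum1_card big_mkcond; apply: eq_bigr => i _.
by rewrite inE; case: eqP.
Qed.

(** Distances are integers, so an infimum below [r + 1] forces a distance at most
    [r], whether or not it is attained. *)
Lemma resilience_le (f : tensor R d n) (x : R) (u : 'I_d -> cube n) (r : nat) :
  (resilience f x u <= (r%:R : R)%:E)%E ->
  exists2 v : 'I_d -> cube n, (hamming u v <= r)%N & tensor_eval f (signs R v) = x.
Proof.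
move=> res; have : (resilience f x u < (r.+1%:R : R)%:E)%E.
  by apply: le_lt_trans res _; rewrite lte_fin ltr_nat.
by case/ereal_inf_lt => _ [v vx <-]; rewrite lte_fin ltr_nat => uv; exists v.
Qed.

End evaluation.

Section law.
Context (R : realType) (disp : measure_display) (T : measurableType disp).
Context (P : probability T R) (d n : nat) (xi : 'I_d -> T -> cube n).
Context (xi_rademacher : independent_rademacher_vectors P xi).

Let W t := flat (xi ^~ t).

Lemma flat_atom (u : {ffun 'I_d * 'I_n -> bool}) :
  W @^-1` [set u] =
  \bigcap_(s in [set` [set: 'I_d]%SET]) (xi s @^-1` [set [ffun i => u (s, i)]]).
Proof.
apply/seteqP; split => t /=.
  by move=> <- s _; apply/ffunP => i; rewrite !ffunE.
move=> tu; apply/ffunP => -[s i]; rewrite ffunE /=.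
by rewrite (tu s) ?ffunE //= inE.
Qed.

Lemma cube_atom (s : 'I_d) (b : cube n) : P (xi s @^-1` [set b]) = (2^-1 ^+ n)%:E.
Proof.
have [_ half indep] := xi_rademacher.1 s.
have -> : xi s @^-1` [set b] =
    \bigcap_(i in [set` [set: 'I_n]%SET]) ((fun t => xi s t i) @^-1` [set b i]).
  apply/seteqP; split => t /=; first by move=> tb i _; rewrite /= tb.
  by move=> tb; apply/ffunP => i; rewrite tb //= inE.
rewrite (indep [set: 'I_n]%SET (fun i => [set b i])).
under eq_bigr => i _.
  have -> : P ((fun t => xi s t i) @^-1` [set b i]) = (2^-1 : R)%:E.
    exact: half.
  over.
by rewrite prodEFin prodr_const cardsT card_ord.
Qed.

Lemma measurable_flat_atom u : measurable (W @^-1` [set u]).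
Proof.
rewrite flat_atom; apply: fin_bigcap_measurable; first exact: finite_finset.
by move=> s _; have [m _ _] := xi_rademacher.1 s; exact: m.
Qed.

Lemma flat_atom_proba u : P (W @^-1` [set u]) = ((2 ^+ #|{: 'I_d * 'I_n}|)^-1)%:E.
Proof.
rewrite flat_atom (xi_rademacher.2 [set: 'I_d]%SET).
under eq_bigr do rewrite cube_atom.
rewrite prodEFin prodr_const cardsT card_ord -exprM -exprVn.
by rewrite card_prod !card_ord mulnC.
Qed.

(** Independence makes all atoms of the joint law equally likely. *)
Lemma flat_law (Q : {ffun 'I_d * 'I_n -> bool} -> bool) :
  P [set t | Q (W t)] = (avg (fun u => (Q u)%:R : R))%:E.
Proof.
have -> : [set t | Q (W t)] = \bigcup_(u in [set` Q]) (W @^-1` [set u]).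
  apply/seteqP; split => t /=; first by move=> QW; exists (W t).
  by move=> [u Qu tu]; rewrite /= in tu; rewrite tu.
rewrite measure_fin_bigcup; first last.
- by move=> u _; exact: measurable_flat_atom.
- apply/trivIsetP => u v _ _ /eqP uv; apply/seteqP; split => t // -[/= tu tv].
  by case: uv; rewrite -tu -tv.
- exact: finite_finset.
transitivity (\sum_(u | Q u) P (W @^-1` [set u]))%E.
  apply/esym/bigfs; first exact: index_enum_uniq.
  by move=> u _; rewrite mem_index_enum.
under eq_bigr do rewrite flat_atom_proba.
rewrite sumEFin /avg mulr_suml big_mkcond; congr EFin; apply: eq_bigr => u _.
by case: (Q u); rewrite ?mul1r ?mul0r.
Qed.

End law.

(** * The tail estimate *)

Lemma sup_prob_block_bound (R : realType) (d n w r : nat) (L : R)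
    (disp : measure_display) (T : measurableType disp) (P : probability T R)
    (xi : 'I_d -> T -> cube n) :
  (0 < d)%N -> (0 < n)%N -> (0 < w)%N -> (w %| n)%N -> 2 <= L ->
  independent_rademacher_vectors P xi ->
  (sup_prob_resilience_le P (@block_tensor R d n w) xi r <=
   (2 * d%:R * (n %/ w)%:R * expR (- (L ^+ 2 / 8)) +
    expR (- ((3 / 16) ^+ d.-1 / 4 * (n %/ w)%:R)) +
    (2 ^+ d.-1 * L ^+ d * Num.sqrt w%:R *
       ((1 + r%:R / Num.sqrt w%:R) ^+ d - 1) + 1) *
    (2 / Num.sqrt ((3 / 16) ^+ d.-1 * n%:R)))%:E)%E.
Proof.
move=> d0 n0 w0 wn L2 ind; apply: ge_ereal_sup => _ [x _ <-].
pose unflat (u : {ffun 'I_d * 'I_n -> bool}) (s : 'I_d) : cube n :=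
  [ffun i => u (s, i)].
have flatK : cancel (@flat d n) unflat.
  by move=> u; apply/funext => s; apply/ffunP => i; rewrite !ffunE.
have unflatK : cancel unflat (@flat d n).
  by move=> u; apply/ffunP => -[s i]; rewrite !ffunE.
pose Q u := `[< (resilience (@block_tensor R d n w) x (unflat u) <= (r%:R : R)%:E)%E >].
have -> : [set t | (resilience (@block_tensor R d n w) x (xi ^~ t) <= (r%:R : R)%:E)%E] =
    [set t | Q (flat (xi ^~ t))].
  by apply/seteqP; split => t /=; rewrite /Q flatK => /asboolP.
rewrite (flat_law ind) lee_fin.
have m0 : (0 < #|'I_(n %/ w)|)%N by rewrite card_ord divn_gt0 // dvdn_leq.
have := @block_resilience R _ 'I_d 'I_(n %/ w) fst (fun p => block_index wn p.2) w w0
  (cell_card wn w0) (Ordinal d0) x L r Q L2 m0.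
rewrite /good_proba !card_ord divnK //; apply => u /asboolP res.
have [v uv vx] := resilience_le res.
exists (flat v); last by rewrite -(tensor_eval_block R wn w0 d0).
by rewrite -[u]unflatK hamming_flat.
Qed.

Lemma ln_ge_half (R : realType) (y : R) : 2 <= y -> 1 / 2 <= ln y.
Proof.
move=> y2; have y0 : 0 < y by lra.
have y2' : y^-1 <= 1 / 2 by rewrite div1r lef_pV2 ?posrE.
have := @le_ln1Dx R (y^-1 - 1); rewrite addrCA subrr addr0 lnV //.
have : 0 < y^-1 by rewrite invr_gt0.
by move=> v0 /(_ ltac:(lra)); lra.
Qed.

Lemma sqrt_ln_ge_half (R : realType) (y : R) : 2 <= y -> 1 / 2 <= Num.sqrt (ln y).
Proof.
move=> y2; have := ln_ge_half y2 => l.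
rewrite -ler_sqr ?nnegrE ?sqrtr_ge0 // sqr_sqrtr; lra.
Qed.

(** The choice [L = 4 * sqrt (ln y)] turns the union bound over cells into
    [2 d m / y ^ 2]; [y] is a free parameter because the two parts of the theorem
    need different values, [n] and [n / w]. *)
Lemma sup_prob_block_log_bound (R : realType) (d n w r : nat) (y : R)
    (disp : measure_display) (T : measurableType disp) (P : probability T R)
    (xi : 'I_d -> T -> cube n) :
  (0 < d)%N -> (0 < n)%N -> (0 < w)%N -> (w %| n)%N -> 2 <= y ->
  independent_rademacher_vectors P xi ->
  (sup_prob_resilience_le P (@block_tensor R d n w) xi r <=
   (2 * d%:R * (n%:R / w%:R) / y ^+ 2 +
    expR (- ((3 / 16) ^+ d.-1 / 4 * (n%:R / w%:R))) +
    (2 ^+ d.-1 * (4 * Num.sqrt (ln y)) ^+ d * Num.sqrt w%:R *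
       ((1 + r%:R / Num.sqrt w%:R) ^+ d - 1) + 1) *
    (2 / Num.sqrt ((3 / 16) ^+ d.-1) / Num.sqrt n%:R))%:E)%E.
Proof.
move=> d0 n0 w0 wn y2 ind; have s2 := sqrt_ln_ge_half y2.
have L2 : 2 <= 4 * Num.sqrt (ln y) by lra.
apply: le_trans (sup_prob_block_bound r d0 n0 w0 wn L2 ind) _; rewrite lee_fin.
have mE : (n %/ w)%:R = n%:R / w%:R :> R.
  by rewrite -[in RHS](divnK wn) natrM mulfK // pnatr_eq0 -lt0n.
have -> : expR (- ((4 * Num.sqrt (ln y)) ^+ 2 / 8)) = y ^- 2.
  rewrite exprMn sqr_sqrtr; last by have := ln_ge_half y2; lra.
  rewrite (_ : _ / 8 = 2%:R * ln y); last by field.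
  by rewrite expRN expRM_natl lnK // posrE; lra.
by rewrite mE -[2 / _ / Num.sqrt _]mulrA -invfM -sqrtrM // exprn_ge0 ?divr_ge0.
Qed.

Lemma bernoulli_increment (R : realType) (d : nat) (x : R) : (0 < d)%N -> 0 <= x ->
  x <= (1 + x) ^+ d - 1.
Proof.
case: d => // d _ x0; rewrite exprS.
have : 1 <= (1 + x) ^+ d by rewrite exprn_ege1 // lerDl.
by nra.
Qed.

Lemma powR_half_nat (R : realType) (x : R) (d : nat) : 0 <= x ->
  x `^ (d%:R / 2) = Num.sqrt x ^+ d.
Proof. by move=> x0; rewrite mulrC powRrM powR12_sqrt // powR_mulrn ?sqrtr_ge0. Qed.

(** The terms of order [1 / sqrt n] are absorbed in the main one: with [r >= 1],
    [sqrt w * ((1 + r / sqrt w) ^ d - 1) >= 1], and [2 * sqrt (ln n) >= 1]. *)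
Lemma block_tail_bound (R : realType) (d : nat) : (0 < d)%N ->
  exists (n0 : nat) (C1 C2 c theta : R),
    [/\ 0 < C1, 0 < C2, 0 < c & 0 < theta] /\
    forall (n w r : nat), (n0 <= n)%N -> (0 < w)%N -> (w %| n)%N ->
      (1 <= r <= n)%N ->
    forall (disp : measure_display) (T : measurableType disp)
      (P : probability T R) (xi : 'I_d -> T -> cube n),
      independent_rademacher_vectors P xi ->
      (sup_prob_resilience_le P (@block_tensor R d n w) xi r <=
        (C1 * (ln n%:R `^ (d%:R / 2)) * Num.sqrt (w%:R / n%:R)
           * ((1 + r%:R / Num.sqrt w%:R) ^+ d - 1)
         + C2 * expR (- (c * (Num.sqrt (n%:R / w%:R) `^ (1 / theta)))))%:E)%E.
Proof.
move=> d0; pose p : R := (3 / 16) ^+ d.-1.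
have p0 : 0 < p by rewrite exprn_gt0 // divr_gt0.
pose K : R := 2 / Num.sqrt p.
have K0 : 0 < K by rewrite divr_gt0 // sqrtr_gt0.
pose K1 : R := 2 ^+ d.-1 * 4 ^+ d * K.
have K10 : 0 < K1 by rewrite /K1 pmulr_rgt0.
(* The summands of C1 bound the terms of order 1 / N and the main term. *)
exists 2%N, (2 ^+ d * (2 * d%:R + K) + K1), 1, (p / 4), (1 / 2); split.
  split => //; try lra.
  by rewrite ltr_wpDl // mulr_ge0 ?exprn_ge0 // addr_ge0 ?mulr_ge0 // ltW.
move=> n w r n2 w0 wn /andP[r1 _] disp T P xi ind.
have n0 : (0 < n)%N by apply: leq_trans n2.
have y2 : 2 <= n%:R :> R by rewrite (ler_nat R 2).
apply: le_trans (sup_prob_block_log_bound r d0 n0 w0 wn y2 ind) _; rewrite lee_fin.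
have -> : 1 / (1 / 2) = 2%:R :> R by field.
have nR : 0 < n%:R :> R by lra.
have wR : 0 < w%:R :> R by rewrite ltr0n.
rewrite powR_mulrn ?sqrtr_ge0 // sqr_sqrtr ?divr_ge0 // mul1r -/p.
rewrite powR_half_nat; last by have := ln_ge_half y2; lra.
have l2 := sqrt_ln_ge_half y2; set l := Num.sqrt (ln _) in l2 *.
rewrite sqrtrM ?ler0n // sqrtrV ?ler0n //.
set q := Num.sqrt w%:R; set N := Num.sqrt n%:R; set G := _ ^+ _ - 1.
have q0 : 0 < q by rewrite sqrtr_gt0.
have q1 : 1 <= q by rewrite -sqrtr1 ler_sqrt // ler1n.
have N1 : 1 <= N by rewrite -sqrtr1 ler_sqrt // ler1n.
have N0 : 0 < N by lra.
have N2 : n%:R = N ^+ 2 by rewrite sqr_sqrtr // ltW.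
have qG : 1 <= q * G.
  have : r%:R / q <= G by rewrite bernoulli_increment // divr_ge0 // ltW.
  rewrite ler_pdivrMr // [G * q]mulrC; apply: le_trans.
  by rewrite ler1n.
have l1 : 1 <= 2 ^+ d * l ^+ d.
  by rewrite -exprMn exprn_ege1 //; lra.
rewrite addrAC lerD2r -/K.
pose X := 2 ^+ d * l ^+ d * (q * G).
have X1 : 1 <= X.
  by rewrite /X -[leLHS]mulr1 ler_pM.
have -> : (2 ^+ d * (2 * d%:R + K) + K1) * l ^+ d * (q / N) * G =
    (2 * d%:R + K) * X / N + K1 * l ^+ d * (q * G) / N.
  by rewrite /X; field; rewrite gt_eqF.
have -> : (2 ^+ d.-1 * (4 * l) ^+ d * q * G + 1) * (K / N) =
    K / N + K1 * l ^+ d * (q * G) / N.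
  by rewrite /K1 exprMn; field; rewrite gt_eqF.
rewrite addrA lerD2r; apply: (@le_trans _ _ ((2 * d%:R + K) / N)).
  rewrite [(_ + K) / N]mulrDl lerD2r -mulrA ler_wpM2l ?mulr_ge0 // N2.
  apply: (@le_trans _ _ (N ^+ 2 / 1 / (N ^+ 2) ^+ 2)).
    rewrite ler_pM2r ?invr_gt0 ?exprn_gt0 // ler_pM2l ?exprn_gt0 //.
    by rewrite lef_pV2 ?posrE // ler1n.
  rewrite divr1 -exprM -[leLHS]invrK lef_pV2 ?posrE ?invr_gt0 ?divr_gt0 ?exprn_gt0 //.
  have -> : (N ^+ 2 / N ^+ (2 * 2))^-1 = N * N by field; rewrite gt_eqF.
  by rewrite ler_peMl // ltW.
rewrite ler_pM2r ?invr_gt0 // ler_peMr //.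
by rewrite addr_ge0 ?mulr_ge0 // ltW.
Qed.

(** * The asymptotic statement *)

Lemma ln_le_self (R : realType) (x : R) : 0 < x -> ln x <= x.
Proof.
by move=> x0; have := @le_ln1Dx R (x - 1); rewrite addrCA subrr addr0 => H; lra.
Qed.

Lemma powR_root_exp (R : realType) (d : nat) (m : R) : (0 < d)%N -> 0 <= m ->
  (m `^ (1 / (2 * d)%:R)) ^+ d = Num.sqrt m.
Proof.
move=> d0 m0; rewrite -powR_mulrn ?powR_ge0 // -powRrM -powR12_sqrt //.
by congr powR; rewrite natrM; field; rewrite pnatr_eq0 -lt0n.
Qed.

(** The logarithm of [m] is [2 d] times that of [z = m `^ (1 / (2 d))], hence at
    most [2 d z]. *)
Lemma sqrt_ln_le_powR (R : realType) (d : nat) (m e : R) :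
  (0 < d)%N -> 1 <= m -> 0 < e ->
  (2 * d%:R / e ^+ 2) ^+ d <= (m `^ (1 / (2 * d)%:R)) ^+ d ->
  Num.sqrt (ln m) <= e * m `^ (1 / (2 * d)%:R).
Proof.
move=> d0 m1 e0; set z := _ `^ _ => ze.
have z0 : 0 < z by rewrite powR_gt0; lra.
have dR : 0 < d%:R :> R by rewrite ltr0n.
have {}ze : 2 * d%:R / e ^+ 2 <= z.
  by rewrite -(@ler_pXn2r _ d) ?nnegrE ?(ltW z0) // ltW // divr_gt0 ?exprn_gt0 ?mulr_gt0.
rewrite ler_pdivrMr ?exprn_gt0 // in ze.
rewrite -ler_sqr ?nnegrE ?mulr_ge0 ?(ltW e0) ?(ltW z0) ?sqrtr_ge0 //.
rewrite sqr_sqrtr ?ln_ge0 //.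
have -> : ln m = 2 * d%:R * ln z.
  by rewrite /z ln_powR natrM; field; rewrite gt_eqF.
apply: (@le_trans _ _ (2 * d%:R * z)).
  by rewrite ler_pM2l ?mulr_gt0 // ln_le_self.
by rewrite exprMn (expr2 z) mulrA ler_pM2r // [e ^+ 2 * z]mulrC.
Qed.

(** The left-hand side is at most [(l * (1 + y) / z) ^+ d]. *)
Lemma power_ratio_le (R : realType) (d : nat) (e l y z : R) :
  (0 < d)%N -> 0 < e -> e <= 1 / 2 -> 0 <= l -> 0 <= y -> 0 < z ->
  l <= e * z -> l * y <= e * z ->
  l ^+ d * ((1 + y) ^+ d - 1) / z ^+ d <= 2 * e.
Proof.
move=> d0 e0 e2 l0 y0 z0 lz ly; rewrite ler_pdivrMr ?exprn_gt0 //.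
apply: (@le_trans _ _ ((l * (1 + y)) ^+ d)).
  by rewrite exprMn ler_wpM2l ?exprn_ge0 ?gerBl.
apply: (@le_trans _ _ ((2 * e * z) ^+ d)).
  by rewrite lerXn2r ?nnegrE ?mulr_ge0 ?addr_ge0 //; lra.
rewrite exprMn ler_pM2r ?exprn_gt0 //; case: d d0 => // d _.
by rewrite exprS ler_piMr ?exprn_ile1 //; lra.
Qed.

(** The bound of [sup_prob_block_log_bound] at [m = n / w].  Its main term is of
    order [(l / z) ^ d * ((1 + y) ^ d - 1)], where [l = sqrt (ln m)],
    [z = m `^ (1 / (2 d))] and [y = r / sqrt w]; both [l / z] and [l * y / z] are at
    most [eps], the latter because [ln m <= ln n]. *)
Lemma log_bound_vanishes (R : realType) (d : nat) : (0 < d)%N ->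
  exists2 B : R, 0 < B & forall eps : R, 0 < eps -> eps <= 1 / 2 ->
  exists2 M : R, 2 <= M & forall n w r : nat, (0 < n)%N -> (0 < w)%N ->
    M <= n%:R / w%:R ->
    r%:R <= eps * (Num.sqrt (w%:R / ln n%:R) * ((n%:R / w%:R) `^ (1 / (2 * d)%:R))) ->
    2 * d%:R * (n%:R / w%:R) / (n%:R / w%:R) ^+ 2 +
    expR (- ((3 / 16) ^+ d.-1 / 4 * (n%:R / w%:R))) +
    (2 ^+ d.-1 * (4 * Num.sqrt (ln (n%:R / w%:R))) ^+ d * Num.sqrt w%:R *
       ((1 + r%:R / Num.sqrt w%:R) ^+ d - 1) + 1) *
    (2 / Num.sqrt ((3 / 16) ^+ d.-1) / Num.sqrt n%:R) <= B * eps.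
Proof.
move=> d0; set p : R := (3 / 16) ^+ d.-1.
have p0 : 0 < p by rewrite exprn_gt0 // divr_gt0.
set K : R := 2 / Num.sqrt p.
have K0 : 0 < K by rewrite divr_gt0 // sqrtr_gt0.
pose K1 : R := 2 ^+ d.-1 * 4 ^+ d * K.
have K10 : 0 < K1 by rewrite /K1 pmulr_rgt0.
have dR : 1 <= d%:R :> R by rewrite ler1n.
exists (2 * d%:R + 4 / p + 2 * K1 + K).
  have : 0 < 4 / p by rewrite divr_gt0.
  lra.
move=> e e0 e2.
(* For sqrt m >= S, both 1 / sqrt m and sqrt (ln m) / z are at most e. *)
pose S : R := 2 + e^-1 + (2 * d%:R / e ^+ 2) ^+ d.
have S1 : 0 < e^-1 by rewrite invr_gt0.
have S2 : 0 <= (2 * d%:R / e ^+ 2) ^+ d.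
  by rewrite exprn_ge0 // divr_ge0 ?exprn_ge0 ?mulr_ge0 // ltW.
have S3 : 2 <= S by rewrite /S; lra.
exists (S ^+ 2); first by nra.
move=> n w r n0 w0 Mm.
have nR : 0 < n%:R :> R by rewrite ltr0n.
have wR : 1 <= w%:R :> R by rewrite ler1n.
set q := Num.sqrt w%:R; set N := Num.sqrt n%:R.
set m : R := n%:R / w%:R in Mm *.
have m4 : 4 <= m by nra.
have mn : m <= n%:R by rewrite ler_pdivrMr; nra.
set mu := Num.sqrt m.
have muS : S <= mu.
  by rewrite -[leLHS]ger0_norm -?sqrtr_sqr ?ler_sqrt //; nra.
have mu2 : m = mu ^+ 2 by rewrite sqr_sqrtr //; lra.
have mue : mu^-1 <= e.
  by rewrite -[leRHS]invrK lef_pV2 ?posrE //; rewrite /S in muS; lra.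
have q1 : 1 <= q by rewrite -sqrtr1 ler_sqrt // ler0n.
have q2 : w%:R = q ^+ 2 by rewrite sqr_sqrtr // ler0n.
have NE : N = mu * q.
  rewrite /mu /q -sqrtrM; last by lra.
  by rewrite /N /m divfK // gt_eqF //; lra.
have ln2 := @sqrt_ln_ge_half R n%:R.
have lm2 := @sqrt_ln_ge_half R m.
set lam := Num.sqrt (ln n%:R) in ln2 *; set l := Num.sqrt (ln m) in lm2 *.
have {}ln2 : 1 / 2 <= lam by apply: ln2; lra.
have {}lm2 : 1 / 2 <= l by apply: lm2; lra.
have llam : l <= lam.
  rewrite ler_sqrt; last by have := @ln_ge_half R n%:R; lra.
  by rewrite ler_ln ?posrE //; lra.
set z := m `^ _.
have z0 : 0 < z by rewrite powR_gt0; lra.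
have zd : z ^+ d = mu by rewrite powR_root_exp //; lra.
have lz : l <= e * z.
  apply: sqrt_ln_le_powR => //; first by lra.
  by rewrite -/z zd; rewrite /S in muS; lra.
rewrite sqrtrM; last by lra.
rewrite sqrtrV; last by have := @ln_ge_half R n%:R; lra.
rewrite -/q -/lam => rq; set y := r%:R / q.
have y0 : 0 <= y by rewrite divr_ge0 //; lra.
have ly : l * y <= e * z.
  have yl : y * lam <= e * z.
    rewrite /y mulrAC ler_pdivrMr; last by lra.
    rewrite -ler_pdivlMr; last by lra.
    apply: le_trans rq _; rewrite le_eqVlt; apply/orP; left; apply/eqP.
    by field; rewrite gt_eqF //; lra.
  by apply: le_trans yl; rewrite mulrC ler_wpM2l.
have main : l ^+ d * ((1 + y) ^+ d - 1) / mu <= 2 * e.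
  by rewrite -zd power_ratio_le ?sqrtr_ge0.
have t1 : 2 * d%:R * m / m ^+ 2 <= 2 * d%:R * e.
  have -> : 2 * d%:R * m / m ^+ 2 = 2 * d%:R * (mu^-1 * mu^-1).
    by rewrite mu2; field; rewrite gt_eqF //; lra.
  rewrite ler_pM2l; last by lra.
  have : 0 < mu^-1 by rewrite invr_gt0; lra.
  by nra.
have t2 : expR (- (p / 4 * m)) <= 4 / p * e.
  have pm : 0 < p / 4 * m by rewrite mulr_gt0 ?divr_gt0 //; lra.
  apply: (@le_trans _ _ ((p / 4 * m)^-1)).
    rewrite expRN lef_pV2 ?posrE ?expR_gt0 //.
    by have := expR_ge1Dx (p / 4 * m); lra.
  have -> : (p / 4 * m)^-1 = 4 / p * (mu^-1 * mu^-1).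
    by rewrite mu2; field; rewrite !gt_eqF //; lra.
  rewrite ler_pM2l ?divr_gt0 //.
  have : 0 < mu^-1 by rewrite invr_gt0; lra.
  by nra.
have t3 : (2 ^+ d.-1 * (4 * l) ^+ d * q * ((1 + y) ^+ d - 1) + 1) * (K / N) <=
    2 * K1 * e + K * e.
  have -> : (2 ^+ d.-1 * (4 * l) ^+ d * q * ((1 + y) ^+ d - 1) + 1) * (K / N) =
     K1 * (l ^+ d * ((1 + y) ^+ d - 1) / mu) + K * (mu^-1 * q^-1).
    by rewrite NE exprMn /K1; field; rewrite !gt_eqF //; lra.
  rewrite lerD //; first by rewrite (_ : 2 * K1 * e = K1 * (2 * e)) ?ler_pM2l //; ring.
  rewrite ler_pM2l // -[leRHS]mulr1 ler_pM ?invr_ge0 //; try lra.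
  by rewrite invf_le1 //; lra.
lra.
Qed.

Lemma ge0_ereal_cvg0 (R : realType) (g : nat -> \bar R) :
  (forall n, (0 <= g n)%E) ->
  (forall eps : R, 0 < eps -> \forall n \near \oo, (g n <= eps%:E)%E) ->
  g @ \oo --> 0%E.
Proof.
move=> g0 gle.
have gfin : \forall n \near \oo, g n \is a fin_num.
  have := gle 1 ltr01; apply: filterS => n gn.
  by rewrite ge0_fin_numE // (le_lt_trans gn) // ltry.
apply/fine_cvgP; split => //; apply/cvgr0Pnorm_le => eps eps0.
near=> n; rewrite /= ger0_norm ?fine_ge0 //.
by rewrite -lee_fin fineK; near: n => //; exact: gle.
Unshelve. all: by end_near. Qed.

Lemma sup_prob_ge0 (R : realType) (d n : nat) (f : tensor R d n)
    (disp : measure_display) (T : measurableType disp) (P : probability T R)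
    (xi : 'I_d -> T -> cube n) (r : nat) :
  (0 <= sup_prob_resilience_le P f xi r)%E.
Proof.
apply: (@le_trans _ _
    (P [set t | (resilience f 0 (xi ^~ t) <= (r%:R : R)%:E)%E])).
  exact: measure_ge0.
by apply: ereal_sup_ubound; exists 0.
Qed.

Lemma block_resilience_aas (R : realType) (d : nat) : (0 < d)%N ->
  forall w : nat -> nat,
    (forall n, (0 < n)%N -> (0 < w n)%N /\ (w n %| n)%N) ->
    (fun n => (w n)%:R : R^o) =o_\oo (fun n => n%:R : R^o) ->
    forall (disp : nat -> measure_display)
      (T : forall n, measurableType (disp n))
      (P : forall n, probability (T n) R)
      (xi : forall n, 'I_d -> T n -> cube n),
      (forall n, independent_rademacher_vectors (P n) (xi n)) ->
      resilience_aas_Omega P (fun n => @block_tensor R d n (w n)) xi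
        (fun n => Num.sqrt ((w n)%:R / ln n%:R)
                  * ((n%:R / (w n)%:R) `^ (1 / (2 * d)%:R))).
Proof.
move=> d0 w wn /eqoP wo disp T P xi ind r /eqoP ro.
have [B B0 HB] := log_bound_vanishes R d0.
apply: ge0_ereal_cvg0 => [n|eta eta0]; first exact: sup_prob_ge0.
pose e : R := Num.min (1 / 2) (eta / B).
have e0 : 0 < e by rewrite lt_min divr_gt0 // divr_gt0.
have e2 : e <= 1 / 2 by rewrite ge_min lexx.
have eB : B * e <= eta by rewrite mulrC -ler_pdivlMr // ge_min lexx orbT.
have [M M2 HM] := HB e e0 e2.
have M0 : 0 < M^-1 by rewrite invr_gt0; lra.
near=> n.
have n0 : (0 < n)%N by near: n; exact: nbhs_infty_gt.
have [w0 wdvd] := wn n n0.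
have wR : 0 < (w n)%:R :> R by rewrite ltr0n.
have mM : M <= n%:R / (w n)%:R.
  rewrite ler_pdivlMr // mulrC -ler_pdivlMr; last lra.
  rewrite mulrC; have : `|(w n)%:R : R^o| <= M^-1 * `|n%:R : R^o|.
    by near: n; exact: wo.
  by rewrite !ger0_norm.
have rn : (r n)%:R <= e * (Num.sqrt ((w n)%:R / ln n%:R) *
    ((n%:R / (w n)%:R) `^ (1 / (2 * d)%:R))).
  have : `|(r n)%:R : R^o| <= e * `|(Num.sqrt ((w n)%:R / ln n%:R) *
    ((n%:R / (w n)%:R) `^ (1 / (2 * d)%:R)) : R^o)| by near: n; exact: ro.
  by rewrite !ger0_norm // mulr_ge0 ?sqrtr_ge0 ?powR_ge0.
apply: le_trans (sup_prob_block_log_bound (r n) d0 n0 w0 wdvd (le_trans M2 mM) (ind n)) _.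
by rewrite lee_fin; apply: le_trans eB; exact: HM.
Unshelve. all: by end_near. Qed.

Theorem claim1p11 (R : realType) (d : nat) (hd : (2 <= d)%N) :
  (exists (n0 : nat) (C1 C2 c theta : R),
    [/\ 0 < C1, 0 < C2, 0 < c & 0 < theta] /\
    forall (n w r : nat), (n0 <= n)%N -> (0 < w)%N -> (w %| n)%N ->
      (1 <= r <= n)%N ->
    forall (disp : measure_display) (T : measurableType disp)
      (P : probability T R) (xi : 'I_d -> T -> cube n),
      independent_rademacher_vectors P xi ->
      (sup_prob_resilience_le P (@block_tensor R d n w) xi r <=
        (C1 * (ln n%:R `^ (d%:R / 2)) * Num.sqrt (w%:R / n%:R)
           * ((1 + r%:R / Num.sqrt w%:R) ^+ d - 1)
         + C2 * expR (- (c * (Num.sqrt (n%:R / w%:R) `^ (1 / theta)))))%:E)%E)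
  /\
  (forall w : nat -> nat,
    (forall n, (0 < n)%N -> (0 < w n)%N /\ (w n %| n)%N) ->
    (fun n => (w n)%:R : R^o) =o_\oo (fun n => n%:R : R^o) ->
    forall (disp : nat -> measure_display)
      (T : forall n, measurableType (disp n))
      (P : forall n, probability (T n) R)
      (xi : forall n, 'I_d -> T n -> cube n),
      (forall n, independent_rademacher_vectors (P n) (xi n)) ->
      resilience_aas_Omega P (fun n => @block_tensor R d n (w n)) xi
        (fun n => Num.sqrt ((w n)%:R / ln n%:R)
                  * ((n%:R / (w n)%:R) `^ (1 / (2 * d)%:R)))).
Proof.
by split; [apply: block_tail_bound | apply: block_resilience_aas]; exact: ltnW.
Qed.
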